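(* Let $S$ be a weakly subsemigroup separable semigroup and let $N$ be a residually finite nilpotent semigroup. Then the direct product $S\times N$ is weakly subsemigroup separable.
   Context: Semigroups are nonempty; $S\times T$ is the direct product with componentwise multiplication. For a semigroup $S$, $s\in S$ and $Y\subseteq S\setminus\{s\}$, we say $s$ can be separated from $Y$ if there exist a finite semigroup $P$ and a semigroup homomorphism $\phi:S\to P$ with $\phi(s)\notin\phi(Y)$. A semigroup $S$ is residually finite if every $s\in S$ can be separated from every singleton $\{y\}$ with $y\in S$, $y\neq s$; it is weakly subsemigroup separable if every $s\in S$ can be separated from every finitely generated subsemigroup $Y\subseteq S\setminus\{s\}$. A semigroup $N$ is nilpotent if it has a zero element $0$ and there is $k\in\{1,2,3,\dots\}$ such that every product of $k$ elements of $N$ equals $0$ (in which case $N$ is called $k$-nilpotent). *)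

(* Defs.v *)
From mathcomp Require Import all_boot.
From mathcomp Require Import boolp classical_sets cardinality.

Set Implicit Arguments.
Unset Strict Implicit.
Unset Printing Implicit Defensive.

Local Open Scope classical_set_scope.

(* [semigroupType] does not exclude the empty carrier, whereas semigroups are
   nonempty here.  Results about a semigroup [S] therefore assume
   [[set: S] !=set0], unless this follows from the other hypotheses. *)

Definition subsemigroup (S : semigroupType) (A : set S) : Prop :=
  A !=set0 /\ forall x y, A x -> A y -> A (x * y)%g.

Definition fg_subsemigroup (S : semigroupType) (Y : set S) : Prop :=
  exists X : set S,
    [/\ finite_set X, X !=set0 & Y = smallest (@subsemigroup S) X].

Definition separated_from (S : semigroupType) (s : S) (Y : set S) : Prop :=
  exists (P : semigroupType) (phi : {multiplicative S -> P}),
    finite_set [set: P] /\ ~ (phi @` Y) (phi s).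

Definition residually_finite (S : semigroupType) : Prop :=
  forall s y : S, y <> s -> separated_from s [set y].

Definition weakly_subsemigroup_separable (S : semigroupType) : Prop :=
  forall (s : S) (Y : set S),
    fg_subsemigroup Y -> Y `<=` ~` [set s] -> separated_from s Y.

(* There is no identity to start from, so a product of [k >= 1] factors is
   a left fold over [k - 1] elements, starting at the first factor. *)
Definition products_eq (N : semigroupType) (z : N) (k : nat) : Prop :=
  forall (x : N) (s : seq N), (size s).+1 = k -> foldl *%g x s = z.

Definition nilpotent_semigroup (N : semigroupType) : Prop :=
  exists z : N,
    [/\ left_zero z *%g, right_zero z *%g &
        exists k : nat, (0 < k)%N /\ products_eq z k].

(* Main.v *)
(** Fix [(s, n)] outside the subsemigroup [Y] generated by a finite set [X].  It
is enough to separate [s] from the fibre [T] of [Y] over [n], and [n] from the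
other second coordinates occurring in [Y].  Since products of at least [k]
generators have second coordinate zero, there are only finitely many such second
coordinates, and [T] is finite when [n] is not zero; as weak subsemigroup
separability implies residual finiteness, these finite cases are settled.  When
[n] is zero, cutting a long product into blocks of length at least [k] shows
that [T] is generated by its elements that are products of at most [2k]
generators, so [T] is a finitely generated subsemigroup of [S] avoiding [s]. *)

From HB Require Import structures.
Require Import Defs.
From mathcomp Require Import all_boot.
From mathcomp Require Import boolp classical_sets cardinality.
From mathcomp Require Import zify.

Set Implicit Arguments.
Unset Strict Implicit.
Unset Printing Implicit Defensive.

Local Open Scope classical_set_scope.

(** * Finite homomorphic images and unions of sets to avoid *)

Section Separation.

(** The trivial semigroup serves as the finite target when there is nothing to avoid. *)
Fact unit_mulA : associative (fun _ _ : unit => tt). Proof. by []. Qed.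
HB.instance Definition _ := isSemigroup.Build unit unit_mulA.

Definition pair_fun (G H K : Type) (f : G -> H) (g : G -> K) (x : G) :=
  (f x, g x).

Fact pair_fun_gmulfM (G H K : semigroupType) (f : {multiplicative G -> H})
  (g : {multiplicative G -> K}) : {morph pair_fun f g : x y / (x * y)%g}.
Proof. by move=> x y; rewrite /pair_fun !gmulfM. Qed.
HB.instance Definition _ (G H K : semigroupType) (f : {multiplicative G -> H})
    (g : {multiplicative G -> K}) :=
  isMultiplicative.Build G (H * K)%type (pair_fun f g) (pair_fun_gmulfM f g).

Definition to_unit (G : Type) (_ : G) := tt.

Fact to_unit_gmulfM (G : semigroupType) : {morph @to_unit G : x y / (x * y)%g}.
Proof. by []. Qed.
HB.instance Definition _ (G : semigroupType) :=
  isMultiplicative.Build G unit (@to_unit G) (@to_unit_gmulfM G).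

Lemma separated_from0 (S : semigroupType) (s : S) : separated_from s set0.
Proof.
exists (unit : semigroupType), (@to_unit S); split.
  exact: finite_finset.
by rewrite image_set0.
Qed.

Lemma separated_fromU (S : semigroupType) (s : S) (A B : set S) :
  separated_from s A -> separated_from s B -> separated_from s (A `|` B).
Proof.
move=> [P [f [finP fA]]] [Q [g [finQ gB]]].
exists (P * Q)%type, (pair_fun f g); split.
  by rewrite -setXTT; apply: finite_setX.
move=> [y [Ay|By] [fE gE]]; first by apply: fA; exists y.
by apply: gB; exists y.
Qed.

Lemma separated_from_sub {S : semigroupType} {s : S} {A B : set S} :
  A `<=` B -> separated_from s B -> separated_from s A.
Proof.
move=> AB [P [f [finP fB]]]; exists P, f; split=> //.
by move=> [y /AB By fE]; apply: fB; exists y.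
Qed.

Lemma separated_from_preimage (S T : semigroupType) (f : {multiplicative S -> T})
    (s : S) (B : set T) :
  separated_from (f s) B -> separated_from s (f @^-1` B).
Proof.
move=> [P [g [finP gB]]]; exists P, (g \o f); split=> //.
by move=> [y By gE]; apply: gB; exists (f y).
Qed.

Lemma separated_from_finite (S : semigroupType) (s : S) (Y : set S) :
  residually_finite S -> finite_set Y -> ~ Y s -> separated_from s Y.
Proof.
move=> S_rf /finite_seqP[r ->] {Y}.
elim: r => [|y r IHr] sNr.
  by rewrite set_nil; exact: separated_from0.
have sub : [set` y :: r] `<=` [set y] `|` [set` r].
  by move=> t /=; rewrite inE => /orP[/eqP|]; [left|right].
apply/(separated_from_sub sub)/separated_fromU.
  by apply: S_rf => ys; apply: sNr; rewrite /= ys mem_head.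
by apply: IHr => /= sr; apply: sNr; rewrite /= inE sr orbT.
Qed.

End Separation.

(** * Monogenic subsemigroups and residual finiteness *)

Section Monogenic.
Variable S : semigroupType.

Let C (y : S) := smallest (@subsemigroup S) [set y].

Lemma smallest_subsemigroup_id (X : set S) x y :
  smallest (@subsemigroup S) X x -> smallest (@subsemigroup S) X y ->
  smallest (@subsemigroup S) X (x * y)%g.
Proof.
by move=> Xx Xy A HA; have [[_ AM] _] := HA; apply: AM; [exact: Xx|exact: Xy].
Qed.

Let Cid y : C y y. Proof. exact: sub_gen_smallest. Qed.

Let C_ind y (A : set S) :
  A y -> (forall a b, A a -> A b -> A (a * b)%g) -> C y `<=` A.
Proof.
by move=> Ay AM; apply: smallest_sub => [|_ ->//]; split; [exists y|].
Qed.

Lemma monogenic_comm y a b : C y a -> C y b -> (a * b = b * a)%g.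
Proof.
have comm_mul (t u v : S) : (u * t = t * u)%g -> (v * t = t * v)%g ->
    (u * v * t = t * (u * v))%g.
  by move=> ut vt; rewrite -mulgA vt mulgA ut mulgA.
(* Two inductions: [a] commutes with the generator first, then with every product of copies of
   it. *)
move=> Ca; have ay : (a * y = y * a)%g.
  by move: a Ca; apply: C_ind => // c d; apply: comm_mul.
move=> Cb; apply/esym; move: b Cb; apply: C_ind => // c d.
exact: comm_mul.
Qed.

Lemma monogenic_factor y t : C y t -> t = y \/ exists2 u, C y u & t = (y * u)%g.
Proof.
(* Membership in [C y] is carried along because the cofactor of a product [a * b] involves [b]
   itself. *)
suff: C y `<=` [set t | C y t /\ (t = y \/ exists2 u, C y u & t = (y * u)%g)].
  by move=> + Ct => /(_ t Ct)[].
apply: C_ind => [|a b [Ca aE] [Cb _]]; first by split; [|left].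
split; first exact: smallest_subsemigroup_id.
right; case: aE => [->|[u Cu ->]]; first by exists b.
by exists (u * b)%g; rewrite ?mulgA//; exact: smallest_subsemigroup_id.
Qed.

Lemma fg_subsemigroup_monogenic y : fg_subsemigroup (C y).
Proof. by exists [set y]; split=> //; exists y. Qed.

Lemma weakly_subsemigroup_separable_residually_finite :
  weakly_subsemigroup_separable S -> residually_finite S.
Proof.
move=> S_wss s y ys.
have [Cys|NCys] := pselect (C y s); last first.
  apply: separated_from_sub (S_wss s _ (fg_subsemigroup_monogenic y) _).
    by move=> _ ->.
  by move=> t Ct /= ts; rewrite ts in Ct.
(* Separation of two points is symmetric, so [y] may be separated from [C s], which contains [s]. *)
have [Csy|NCsy] := pselect (C s y); last first.
  have [t Ct /= ts|P [f [finP fNs]]] :=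
    S_wss y _ (fg_subsemigroup_monogenic s).
    by rewrite ts in Ct.
  exists P, f; split=> // -[_ -> fE]; apply: fNs.
  by exists s.
(* Here [s] and [y] generate the same finite cyclic group, with identity [e];
   the quotient [u] of [s] by [y] can be separated from the subsemigroup
   [[set e]]. *)
have [/esym//|[u Cu sE]] := monogenic_factor Cys.
have [//|[v Csv yE]] := monogenic_factor Csy.
have Cv : C y v.
  move: v Csv {yE}; apply: C_ind => // a b.
  exact: smallest_subsemigroup_id.
pose e := (u * v)%g.
have Ce : C y e by exact: smallest_subsemigroup_id.
have ye : (y * e = y)%g by rewrite /e mulgA -sE -yE.
have Ce1 t : C y t -> (t * e = t)%g.
  move=> /monogenic_factor[->//|[w Cw ->]].
  by rewrite -mulgA (monogenic_comm Cw Ce) mulgA ye.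
(* With [e = w * y] one gets [u = e * u = w * s], so a homomorphism identifying [s] and [y] also
   identifies [u] and [e]. *)
have [w wE] : exists w, e = (w * y)%g.
  have [uy|[u' Cu' uE]] := monogenic_factor Cu.
    by exists v; rewrite /e uy (monogenic_comm _ Cv).
  exists (u' * v)%g; rewrite /e uE -mulgA; apply: monogenic_comm => //.
  exact: smallest_subsemigroup_id.
have sub_e : subsemigroup [set e].
  by split; [exists e | move=> _ _ -> ->; exact: Ce1].
have Ee : C e = [set e] by exact: smallest_id.
have [t|P [f [finP fNu]]] := S_wss u _ (fg_subsemigroup_monogenic e).
  by rewrite Ee => -> /= eu; apply: ys; rewrite sE -eu ye.
exists P, f; split=> // -[_ -> fE]; apply: fNu; exists e; first exact: Cid.
have eu : (e * u = u)%g by rewrite (monogenic_comm Ce Cu) Ce1.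
by rewrite -eu wE -mulgA -sE !gmulfM fE.
Qed.

End Monogenic.

(** * Products of generators, graded by length *)

Section Words.
Variables (S : semigroupType) (X : set S).

(* The products of exactly [m.+1] elements of [X]. *)
Fixpoint words (m : nat) : set S :=
  if m is m'.+1 then [set (a * x)%g | a in words m' & x in X] else X.

Lemma words_mul m p a b :
  words m a -> words p b -> words (m + p).+1 (a * b)%g.
Proof.
elim: p b => [|p IHp] b ma.
  by rewrite addn0 => Xb; exists a => //; exists b.
move=> [c pc [x Xx <-]]; rewrite mulgA addnS.
by exists (a * c)%g; [exact: IHp | exists x].
Qed.

Lemma words_split m p t : words (m + p).+1 t ->
  exists a b, [/\ words m a, words p b & t = (a * b)%g].
Proof.
elim: p t => [|p IHp] t.
  by rewrite addn0 => -[a ma [x Xx <-]]; exists a, x.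
rewrite addnS => -[c /IHp[a [b [ma pb ->]]] [x Xx <-]].
exists a, (b * x)%g; split=> //; last by rewrite mulgA.
by exists b => //; exists x.
Qed.

Lemma words_foldl m t : words m t ->
  exists (x : S) (r : seq S), size r = m /\ t = foldl *%g x r.
Proof.
elim: m t => [|m IHm] t /= => [Xt|[a /IHm[x [r [<- ->]]] [y Xy <-]]].
  by exists t, [::].
by exists x, (rcons r y); rewrite size_rcons foldl_rcons.
Qed.

Lemma finite_words m : finite_set X -> finite_set (words m).
Proof. by move=> finX; elim: m => //= m IHm; exact: finite_image2. Qed.

Lemma smallest_subsemigroupE :
  X !=set0 -> smallest (@subsemigroup S) X = \bigcup_m words m.
Proof.
move=> X0; apply/seteqP; split.
  apply: smallest_sub => [|x Xx]; last by exists 0.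
  split=> [|x y [m _ mx] [p _ py]].
    by have [x Xx] := X0; exists x, 0.
  by exists (m + p).+1 => //; exact: words_mul.
move=> t [m _]; elim: m t => [|m IHm] t /=; first exact: sub_gen_smallest.
move=> [a /IHm Ca [x Xx <-]]; apply: smallest_subsemigroup_id => //.
exact: sub_gen_smallest.
Qed.

End Words.

Lemma words_image (S T : semigroupType) (f : {multiplicative S -> T})
    (X : set S) m t :
  words X m t -> words (f @` X) m (f t).
Proof.
elim: m t => [|m IHm] t /=; first by move=> Xt; exists t.
move=> [a /IHm fa [x Xx <-]]; exists (f a) => //.
by exists (f x); rewrite ?gmulfM//; exists x.
Qed.

(** * Fibres of a finitely generated subsemigroup over the nilpotent factor *)

Section NilpotentProduct.
Variables (S N : semigroupType) (z : N) (k : nat).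
Hypotheses (zl : left_zero z *%g) (Nk : products_eq z k.+1).
Variable X : set (S * N).
Hypotheses (finX : finite_set X) (X0 : X !=set0).

Let Y := smallest (@subsemigroup (S * N)%type) X.

(** An element of [words X k] has [k.+1] factors, just enough for [Nk]; any further factors on the
    right are absorbed by [zl]. *)
Lemma words_snd m (p : S * N) : (k <= m)%N -> words X m p -> p.2 = z.
Proof.
have kz q : words X k q -> q.2 = z.
  by move=> /(words_image snd)/words_foldl[x [r [rk ->]]]; apply: Nk; rewrite rk.
case: ltngtP => // [km _|<- _]; last exact: kz.
rewrite -(subnK km) addnS addnC => /words_split[a [b [/kz az _ ->]]].
by rewrite /= az zl.
Qed.

Let short m := \bigcup_(i in `I_m) words X i.

Let finite_short m : finite_set (short m).
Proof. by apply: bigcup_finite => // i _; exact: finite_words. Qed.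

Lemma subsemigroup_nonzero_short (p : S * N) : Y p -> p.2 <> z -> short k p.
Proof.
rewrite /Y smallest_subsemigroupE// => -[m _ mp] pz; exists m => //=.
by rewrite ltnNge; apply/negP => /words_snd/(_ mp).
Qed.

Lemma finite_snd_subsemigroup : finite_set (snd @` Y).
Proof.
apply: (@sub_finite_set _ _ (z |` snd @` short k)).
  move=> _ [p Yp <-]; have [->|pz] := pselect (p.2 = z); first by left.
  by right; exists p => //; exact: subsemigroup_nonzero_short.
by rewrite finite_setU; split; [exact: finite_set1 | exact: finite_image].
Qed.

Lemma finite_nonzero_fiber n : n <> z -> finite_set [set t | Y (t, n)].
Proof.
move=> nz; apply: (@sub_finite_set _ _ (fst @` short k)).
  by move=> t Yt; exists (t, n) => //; exact: subsemigroup_nonzero_short.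
exact: finite_image.
Qed.

Lemma fg_zero_fiber : fg_subsemigroup [set t | Y (t, z)].
Proof.
(* The bound leaves room for two blocks: from index [k.+1.*2] on, removing [k.+1] factors leaves an
   index still at least [k], so both blocks have second coordinate [z]. *)
pose G := [set t | short k.+1.*2 (t, z)].
have YE : Y = \bigcup_m words X m by exact: smallest_subsemigroupE.
have wordsz m p : (k <= m)%N -> words X m p -> words X m (p.1, z).
  by move=> km mp; rewrite -(words_snd km mp) -surjective_pairing.
have [x Xx] := X0.
(* A word of index [k] shows that the fibre and its generating set [G] are nonempty. *)
have [p kp] : words X k !=set0.
  by elim: k => [|m [q mq]]; [exists x | exists (q * x)%g, q => //; exists x].
have G0 : G p.1.
  by exists k; [rewrite /= -addnn -addSnnS ltn_addr | exact: wordsz].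
have finG : finite_set G.
  apply: (@sub_finite_set _ _ (fst @` short k.+1.*2)); last exact: finite_image.
  by move=> t Gt; exists (t, z).
exists G; split=> //; first by exists p.1.
apply/seteqP; split=> [t|]; last first.
  apply: smallest_sub => [|t [m _ mt]]; last by rewrite /= YE; exists m.
  split=> [|a b Ya Yb].
    by exists p.1 => /=; rewrite YE; exists k => //; exact: wordsz.
  have zz : ((a, z) * (b, z))%g = ((a * b)%g, z) by congr pair; exact: zl.
  by rewrite /= -zz; exact: smallest_subsemigroup_id.
rewrite /= YE => -[m _]; elim/ltn_ind: m t => m IHm t mt.
have [mk|km] := ltnP m k.+1.*2; first by apply: sub_gen_smallest; exists m.
have mE : m = (k + (m - k.+1)).+1 by lia.
(* The first [k.+1] factors give an element of [G]; the rest is a shorter word over [z], handled by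
   induction. *)
move: mt; rewrite mE => /words_split[a [b [ka mb /(congr1 fst)/= ->]]].
apply: smallest_subsemigroup_id.
  by apply: sub_gen_smallest; exists k; [rewrite /=; lia | exact: wordsz].
apply: (IHm (m - k.+1)); first lia.
by apply: wordsz => //; lia.
Qed.

End NilpotentProduct.

Theorem theorem4p5 (S N : semigroupType)
    (S_nonempty : [set: S] !=set0)
    (S_wss : weakly_subsemigroup_separable S)
    (N_rf : residually_finite N)
    (N_nil : nilpotent_semigroup N) :
  weakly_subsemigroup_separable (S * N)%type.
Proof.
move=> [s n] Y [X [finX X0 YE]] YNsn.
(* Length zero is excluded by positivity, so [k] now denotes the predecessor of the nilpotency
   length. *)
have [z [zl _ [[[]//|k [_ Nk]]]]] := N_nil.
have NYsn : ~ Y (s, n) by move=> /YNsn; apply.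
have cover : Y `<=` fst @^-1` [set t | Y (t, n)] `|`
    snd @^-1` (snd @` Y `\ n).
  move=> [t m] Ytm; have [mn|mn] := pselect (m = n); first by left; rewrite /= -mn.
  by right; split=> //; exists (t, m).
apply: (separated_from_sub cover).
apply: separated_fromU; apply: separated_from_preimage => /=; last first.
  apply: separated_from_finite => // [|[_ /(_ erefl)]//].
  by apply: finite_setD; rewrite YE; exact: (finite_snd_subsemigroup zl Nk).
have [nz|nz] := pselect (n = z).
  apply: S_wss => [|t /= Yt ts]; last by apply: NYsn; rewrite -ts.
  by rewrite YE nz; exact: (fg_zero_fiber zl Nk).
apply: separated_from_finite => //.
  exact: weakly_subsemigroup_separable_residually_finite.
by rewrite YE; exact: (finite_nonzero_fiber zl Nk).
Qed.
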